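(* Let $p_1, \ldots, p_k$ be any collection of $132$-avoiding permutations (patterns), and let $q_1, \ldots, q_k$ be patterns such that, for each $i$, $q_i$ is contained in $\varphi(p_i)$ and there is an instance of $p_i$ contained in $q_i$ (a subsequence of $q_i$ order-isomorphic to $p_i$) which contains no left-to-right minima of $q_i$. Then, for every $n \geq 0$, $\varphi$ restricts to a bijection between $S_n(132, p_1, \ldots, p_k)$ and $A_{2n+1}(132, q_1, \ldots, q_k)$; in particular, these two sets are equinumerous.
   Context: A permutation $w = w_1w_2\cdots w_n$ of length $n$ is a sequence containing each of the integers $1,\dots,n$ exactly once (for $n=0$ there is exactly one, the empty permutation). It is alternating if $w_1 < w_2 > w_3 < w_4 > \cdots$. A sequence $w = w_1\cdots w_n$ of distinct integers contains a permutation $p$ of length $m$ (a pattern) if there are indices $1 \le i_1 < \cdots < i_m \le n$ such that $w_{i_1}\cdots w_{i_m}$ is order-isomorphic to $p$ (same relative order of entries); such a subsequence is an instance of $p$. Otherwise $w$ avoids $p$. An entry $w_i$ is a left-to-right minimum of $w$ if $w_i < w_j$ for all $j < i$ (so $w_1$ is always one). $S_n(r_1,\dots,r_m)$ is the set of permutations of length $n$ avoiding all of $r_1,\dots,r_m$, and $A_n(r_1,\dots,r_m)$ is the set of alternating permutations of length $n$ avoiding all of $r_1,\dots,r_m$. Binary trees: each vertex has an optional left child and an optional right child, with left and right distinguished. For a finite sequence $w = w_1\cdots w_n$ of distinct integers, the labeled decreasing binary tree $T(w)$ is defined recursively: if $w$ is empty, $T(w)$ is empty; otherwise, if $w_k$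 is the maximal entry, the root is labeled $w_k$, its left subtree is $T(w_1\cdots w_{k-1})$ and its right subtree is $T(w_{k+1}\cdots w_n)$. This is a bijection between permutations of length $n$ and decreasing binary trees labeled by $\{1,\dots,n\}$. If $w$ avoids $132$, then at each vertex $v$ of $T(w)$ every label in the left subtree at $v$ is larger than every label in the right subtree at $v$; each unlabeled binary tree with $m$ vertices has exactly one decreasing labeling by $\{1,\dots,m\}$ with this property, and it is called the labeled tree associated to the unlabeled tree. The completion $C(T)$ of an unlabeled binary tree $T$ is obtained by adding vertices to $T$ so that every vertex of $T$ has two children in $C(T)$ and every vertex of $C(T)$ not in $T$ has no children in $C(T)$ (the completion of the empty tree is a single vertex). If $T$ has $n$ vertices, $C(T)$ has $2n+1$ vertices. The map $\varphi: S_n(132) \to A_{2n+1}(132)$ (defined for every $n \ge 0$): given $w \in S_n(132)$, form $T(w)$, erase its labels, take the completion, take the labeled tree associated to this completion, and let $\varphi(w)$ be the permutation of length $2n+1$ whose image under $T$ is that labeled tree. Equivalently, $\varphi(w)$ is the unique member of $A_{2n+1}(132)$ whose sequence of even-indexed entries is order-isomorphic to $w$. *)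

(* Defs.v *)
From mathcomp Require Import all_boot.
From mathcomp Require Import zify.

Set Implicit Arguments.
Unset Strict Implicit.
Unset Printing Implicit Defensive.

(* A permutation w_1 ... w_n is the sequence of its entries; positions are
   0-based, so that w_i is [nth 0 w i.-1]. *)
Definition is_perm (w : seq nat) : bool := perm_eq w (iota 1 (size w)).

Definition order_iso (u v : seq nat) : bool :=
  (size u == size v) &&
  [forall i : 'I_(size u), forall j : 'I_(size u),
     (nth 0 u i < nth 0 u j) == (nth 0 v i < nth 0 v j)].

(* The bit vector [m] selects the positions of the subsequence. *)
Definition instance (w p : seq nat) (m : (size w).-tuple bool) : bool :=
  order_iso (mask m w) p.

Definition contains (w p : seq nat) : bool :=
  [exists m : (size w).-tuple bool, instance p m].

Definition avoids (w p : seq nat) : bool := ~~ contains w p.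

Definition lr_min (w : seq nat) (i : nat) : bool :=
  [forall j : 'I_i, nth 0 w i < nth 0 w j].

Definition lr_min_free_instance (w p : seq nat) (m : (size w).-tuple bool) :=
  instance p m && [forall i : 'I_(size w), tnth m i ==> ~~ lr_min w i].

Definition alternating (w : seq nat) : bool :=
  [forall i : 'I_(size w).-1,
     if odd i then nth 0 w i.+1 < nth 0 w i else nth 0 w i < nth 0 w i.+1].

Definition pat132 : seq nat := [:: 1; 3; 2].

(* S_n(rs) and A_n(rs) as duplicate-free lists, so that [size] is the
   cardinality. *)
Definition Sav (n : nat) (rs : seq (seq nat)) : seq (seq nat) :=
  [seq w <- permutations (iota 1 n) | all (avoids w) rs].

Definition Aav (n : nat) (rs : seq (seq nat)) : seq (seq nat) :=
  [seq w <- Sav n rs | alternating w].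

Lemma mem_Sav n rs w :
  (w \in Sav n rs) = perm_eq w (iota 1 n) && all (avoids w) rs.
Proof. by rewrite mem_filter mem_permutations andbC. Qed.

Lemma Sav_uniq n rs : uniq (Sav n rs).
Proof. by rewrite filter_uniq // permutations_uniq. Qed.

Lemma Aav_uniq n rs : uniq (Aav n rs).
Proof. by rewrite filter_uniq // Sav_uniq. Qed.

(* Binary trees with vertices labeled in L; [Empty] is the empty tree, that is,
   an absent child.  Unlabeled trees are the trees with L = unit. *)
Inductive tree (L : Type) : Type :=
| Empty
| Node of tree L & L & tree L.
Arguments Empty {L}.

Definition utree := tree unit.

Fixpoint inorder L (t : tree L) : seq L :=
  if t is Node l x r then inorder l ++ x :: inorder r else [::].

Definition nvertices L (t : tree L) : nat := size (inorder t).

Fixpoint erase L (t : tree L) : utree :=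
  if t is Node l _ r then Node (erase l) tt (erase r) else Empty.

Definition maxentry (w : seq nat) : nat := foldr maxn 0 w.

(* [fuel] only ensures termination, see [treeofE]. *)
Fixpoint treeof_rec (fuel : nat) (w : seq nat) : tree nat :=
  if fuel is fuel'.+1 then
    if w is [::] then Empty else
    let k := index (maxentry w) w in
    Node (treeof_rec fuel' (take k w)) (maxentry w)
         (treeof_rec fuel' (drop k.+1 w))
  else Empty.

(* The tree T(w). *)
Definition treeof (w : seq nat) : tree nat := treeof_rec (size w) w.

Fixpoint completion (t : utree) : utree :=
  if t is Node l x r then Node (completion l) x (completion r)
  else Node Empty tt Empty.

Fixpoint decreasing (t : tree nat) : bool :=
  if t is Node l x r then
    [&& all (fun y => y < x) (inorder l), all (fun y => y < x) (inorder r),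
        decreasing l & decreasing r]
  else true.

Fixpoint left_above_right (t : tree nat) : bool :=
  if t is Node l _ r then
    [&& all (fun y => all (fun z => z < y) (inorder r)) (inorder l),
        left_above_right l & left_above_right r]
  else true.

Definition is_assoc_labeling (t : utree) (t' : tree nat) : Prop :=
  [/\ erase t' = t, perm_eq (inorder t') (iota 1 (nvertices t)),
      decreasing t' & left_above_right t'].

(* Labels by {a+1, ..., a+m}: the root gets the largest label and the labels of
   the left subtree exceed those of the right one.  See [assoc_labelingP] and
   [assoc_labeling_unique] for the characterization. *)
Fixpoint labeling_from (a : nat) (t : utree) : tree nat :=
  if t is Node l _ r then
    Node (labeling_from (a + nvertices r) l)
         (a + nvertices r + nvertices l).+1
         (labeling_from a r)
  else Empty.

Definition assoc_labeling (t : utree) : tree nat := labeling_from 0 t.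

(* The inverse of T reads the labels in order, see [treeof_inorder] and
   [treeof_phi]. *)
Definition phi (w : seq nat) : seq nat :=
  inorder (assoc_labeling (completion (erase (treeof w)))).

Lemma maxentry_ge w x : x \in w -> x <= maxentry w.
Proof.
elim: w => //= y w IH; rewrite inE => /orP[/eqP->|/IH h]; rewrite leq_max.
  by rewrite leqnn.
by rewrite h orbT.
Qed.

Lemma maxentry_in w : w != [::] -> maxentry w \in w.
Proof.
elim: w => //= x [|y w] IH _; first by rewrite /= maxn0 inE eqxx.
rewrite /maxn; case: ltnP => _; last by rewrite inE eqxx.
by rewrite inE IH ?orbT.
Qed.

Lemma treeof_recS f w : w != [::] ->
  treeof_rec f.+1 w =
  Node (treeof_rec f (take (index (maxentry w) w) w)) (maxentry w)
       (treeof_rec f (drop (index (maxentry w) w).+1 w)).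
Proof. by case: w. Qed.

Lemma size_split_max w : w != [::] ->
  size (take (index (maxentry w) w) w) < size w /\
  size (drop (index (maxentry w) w).+1 w) < size w.
Proof.
move=> /maxentry_in; rewrite -index_mem => hk.
by rewrite size_drop size_take hk; lia.
Qed.

Lemma treeof_rec_fuel f g w :
  size w <= f -> size w <= g -> treeof_rec f w = treeof_rec g w.
Proof.
elim: f g w => [|f IH] g w.
  by rewrite leqn0 size_eq0 => /eqP->; case: g.
have [->|w0] := eqVneq w [::]; first by case: g.
have [ht hd] := size_split_max w0.
case: g => [|g] hf hg; first by rewrite leqn0 size_eq0 (negbTE w0) in hg.
rewrite !treeof_recS //; congr Node; apply: IH;
  by rewrite -ltnS; apply: leq_trans hf || apply: leq_trans hg.
Qed.

Lemma treeofE w : w != [::] ->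
  treeof w = Node (treeof (take (index (maxentry w) w) w)) (maxentry w)
                  (treeof (drop (index (maxentry w) w).+1 w)).
Proof.
move=> w0; have [ht hd] := size_split_max w0.
rewrite {1}/treeof; case E: (size w) => [|n]; first by rewrite -(size_eq0 w) E in w0.
by rewrite treeof_recS //; congr Node; apply: treeof_rec_fuel;
  rewrite // -ltnS -E.
Qed.

Lemma treeof_inorder t : decreasing t -> treeof (inorder t) = t.
Proof.
elim: t => [|l IHl x r IHr] //= /and4P[al ar dl dr].
have xin : x \in inorder l ++ x :: inorder r by rewrite mem_cat inE eqxx orbT.
have mE : maxentry (inorder l ++ x :: inorder r) = x.
  apply/eqP; rewrite eqn_leq maxentry_ge // andbT.
  have : maxentry (inorder l ++ x :: inorder r) \in inorder l ++ x :: inorder r.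
    by apply: maxentry_in; case: (inorder l).
  rewrite mem_cat inE => /or3P[/(allP al)/ltnW//|/eqP->//|/(allP ar)/ltnW//].
have xl : x \notin inorder l by apply/negP => /(allP al); rewrite ltnn.
rewrite treeofE; last by case: (inorder l).
rewrite mE index_cat (negbTE xl) /= eqxx addn0 take_size_cat //.
have -> : inorder l ++ x :: inorder r = rcons (inorder l) x ++ inorder r.
  by rewrite cat_rcons.
by rewrite drop_size_cat ?size_rcons // IHl ?IHr.
Qed.

Lemma inorder_treeof w : inorder (treeof w) = w.
Proof.
have [n] := ubnP (size w); elim: n w => // n IH w hw.
have [->//|w0] := eqVneq w [::]; rewrite treeofE //=.
have [ht hd] := size_split_max w0.
rewrite !IH; last 2 first.
- exact: leq_trans hd hw.
- exact: leq_trans ht hw.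
have := maxentry_in w0; rewrite -index_mem => hk.
have /(congr1 (cat (take (index (maxentry w) w) w))) := drop_nth 0 hk.
by rewrite cat_take_drop nth_index ?maxentry_in.
Qed.

Lemma nvertices_erase L (t : tree L) : nvertices (erase t) = nvertices t.
Proof.
rewrite /nvertices; elim: t => //= l IHl x r IHr.
by rewrite !size_cat /= IHl IHr.
Qed.

Lemma nvertices_completion t : nvertices (completion t) = (nvertices t).*2.+1.
Proof.
rewrite /nvertices; elim: t => //= l IHl x r IHr.
by rewrite !size_cat /= IHl IHr; lia.
Qed.

Lemma labeling_fromP a t :
  [/\ erase (labeling_from a t) = t,
      perm_eq (inorder (labeling_from a t)) (iota a.+1 (nvertices t)),
      decreasing (labeling_from a t) & left_above_right (labeling_from a t)].
Proof.
elim: t a => [|l IHl [] r IHr] a //=.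
have [-> pl dl al] := IHl (a + nvertices r).
have [-> pr dr ar] := IHr a.
have inl := perm_mem pl; have inr := perm_mem pr; split=> //.
- rewrite /nvertices /= size_cat /= -/(nvertices l) -/(nvertices r).
  have -> : nvertices l + (nvertices r).+1 = nvertices r + (nvertices l + 1).
    by lia.
  rewrite !iotaD /= perm_catC catA perm_sym.
  rewrite perm_catC cat_cons cat0s !addSn cat_cons perm_cons.
  by apply: perm_cat; rewrite perm_sym.
- rewrite dl dr !andbT; apply/andP; split; apply/allP => y.
    by rewrite inl mem_iota; lia.
  by rewrite inr mem_iota; lia.
- rewrite al ar !andbT; apply/allP => y; rewrite inl mem_iota => hy.
  by apply/allP => z; rewrite inr mem_iota; lia.
Qed.

Lemma assoc_labelingP t : is_assoc_labeling t (assoc_labeling t).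
Proof. exact: labeling_fromP. Qed.

Lemma labeling_from_unique a t t' :
  erase t' = t -> perm_eq (inorder t') (iota a.+1 (nvertices t)) ->
  decreasing t' -> left_above_right t' -> t' = labeling_from a t.
Proof.
elim: t' a t => [|l IHl x r IHr] a t <- //= pt /and4P[xl xr dl dr].
move=> /and3P[/allP lr al ar].
rewrite !nvertices_erase.
have nE : nvertices (Node (erase l) tt (erase r))
          = nvertices r + (nvertices l + 1).
  rewrite -(nvertices_erase l) -(nvertices_erase r) /nvertices /= size_cat /=.
  by lia.
have srt : sorted ltn (sort leq (inorder r) ++ sort leq (inorder l) ++ [:: x]).
  have unq : uniq (inorder l ++ x :: inorder r).
    by rewrite (perm_uniq pt) iota_uniq.
  have [ul ur] : uniq (inorder l) /\ uniq (inorder r).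
    by move: unq; rewrite cat_uniq /= => /and3P[-> _ /andP[_ ->]].
  rewrite (sorted_pairwise ltn_trans) !pairwise_cat /= !andbT.
  rewrite -!(sorted_pairwise ltn_trans) !ltn_sorted_uniq_leq !sort_uniq ul ur.
  rewrite !sort_sorted ?andbT; try exact: leq_total.
  rewrite !allrel_catr; apply/andP; split.
    apply/andP; split; apply/allrelP => z y; rewrite !mem_sort => hz.
      by move=> hy; exact: (allP (lr y hy)).
    by rewrite inE => /eqP->; exact: (allP xr).
  apply/allrelP => z y; rewrite mem_sort inE => hz /eqP->.
  exact: (allP xl).
have E : sort leq (inorder r) ++ sort leq (inorder l) ++ [:: x]
         = iota a.+1 (nvertices r + (nvertices l + 1)).
  apply: (irr_sorted_eq ltn_trans ltnn srt (iota_ltn_sorted _ _)).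
  move=> z; rewrite -nE -(perm_mem pt) !mem_cat !mem_sort !inE.
  by case: (z \in inorder l); case: (z \in inorder r); case: (z == x).
move: E; rewrite iotaD => /eqP; rewrite eqseq_cat; last first.
  by rewrite size_sort size_iota.
case/andP=> /eqP Er; rewrite iotaD eqseq_cat; last first.
  by rewrite size_sort size_iota.
case/andP=> /eqP El /eqP[Ex].
congr Node.
- apply: IHl => //; rewrite nvertices_erase -addSn -El perm_sym.
  by rewrite perm_sort.
- by rewrite Ex; lia.
- by apply: IHr => //; rewrite nvertices_erase -Er perm_sym perm_sort.
Qed.

Lemma assoc_labeling_unique t t' :
  is_assoc_labeling t t' -> t' = assoc_labeling t.
Proof. by case; apply: (@labeling_from_unique 0). Qed.

Lemma treeof_phi w :
  treeof (phi w) = assoc_labeling (completion (erase (treeof w))).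
Proof.
apply: treeof_inorder.
by case: (assoc_labelingP (completion (erase (treeof w)))).
Qed.

Lemma perm_phi w : perm_eq (phi w) (iota 1 (size w).*2.+1).
Proof.
have [_ + _ _] := assoc_labelingP (completion (erase (treeof w))).
have <- : nvertices (treeof w) = size w by rewrite /nvertices inorder_treeof.
by rewrite nvertices_completion nvertices_erase.
Qed.

(* Main.v *)
(** In a 132-avoiding alternating sequence of odd length, the odd-indexed
    entries (valleys) are exactly the left-to-right minima, hence decreasing,
    and a valley is smaller than a later peak iff the peak right after the
    valley is at most that later peak.  So the peaks, i.e. the even-indexed
    entries, determine the order type, and [phi w] is the unique such
    permutation whose peaks are order-isomorphic to [w].  An instance of [p]
    in [w] sits on peaks of [phi w]; adding the valley just before each of them
    and the last valley gives an instance of [phi p], hence of [q].  Conversely,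
    in an instance of [q] in [phi w], the entries which are not left-to-right
    minima of [q] sit on peaks, so they exhibit [p] in [w]. *)

Require Import Defs.
From mathcomp Require Import all_boot.
From mathcomp Require Import zify.

Set Implicit Arguments.
Unset Strict Implicit.
Unset Printing Implicit Defensive.

(** * Pattern containment as an embedding of positions *)

Definition avoids132 (w : seq nat) : Prop :=
  forall i j k, i < j -> j < k -> k < size w ->
    nth 0 w i < nth 0 w k -> nth 0 w k < nth 0 w j -> False.

(** Here [f] is a plain function on naturals, constrained only below [size p], so that containments
    compose as functions, which bit vectors do not do directly. *)
Definition embeds (f : nat -> nat) (w p : seq nat) : Prop :=
  [/\ forall i j, i < j -> j < size p -> f i < f j,
      forall i, i < size p -> f i < size w
    & forall i j, i < size p -> j < size p ->
        (nth 0 w (f i) < nth 0 w (f j)) = (nth 0 p i < nth 0 p j)].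

Lemma order_isoP (u v : seq nat) :
  reflect (size u = size v /\ forall i j, i < size u -> j < size u ->
             (nth 0 u i < nth 0 u j) = (nth 0 v i < nth 0 v j))
          (order_iso u v).
Proof.
apply: (iffP andP) => [[/eqP E /forallP h]|[E h]]; split=> //; first 1 last.
- exact/eqP.
- by apply/forallP => i; apply/forallP => j; apply/eqP/h.
- by move=> i j hi hj; have /forallP/(_ (Ordinal hj))/eqP := h (Ordinal hi).
Qed.

Lemma alternatingP (w : seq nat) :
  reflect (forall i, i.+1 < size w ->
             if odd i then nth 0 w i.+1 < nth 0 w i
             else nth 0 w i < nth 0 w i.+1)
          (alternating w).
Proof.
apply: (iffP forallP) => [h i hi|h i].
  have hi' : i < (size w).-1 by lia.
  exact: (h (Ordinal hi')).
by apply: h; have := ltn_ord i; lia.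
Qed.

(** The embedding enumerates the selected positions in increasing order. The second conclusion
    remembers that they are selected, so that the condition on left-to-right minima can be applied
    to them. *)
Lemma instance_embeds (w p : seq nat) (m : (size w).-tuple bool) :
  instance p m ->
  exists2 f, embeds f w p & forall i, i < size p -> nth false m (f i).
Proof.
case/order_isoP => sE hE.
set s := mask m (iota 0 (size w)).
have ms : size s = size p.
  by rewrite -sE !size_mask ?size_tuple ?size_iota.
have mE : mask m w = [seq nth 0 w i | i <- s].
  by rewrite map_mask map_nth_iota0 // take_size.
have srt : sorted ltn s.
  by apply: sorted_mask; [exact: ltn_trans | exact: iota_ltn_sorted].
have nE i : i < size p -> nth 0 (mask m w) i = nth 0 w (nth 0 s i).
  by move=> hi; rewrite mE (nth_map 0) ?ms.
have sin i : i < size p -> nth 0 s i \in s by move=> hi; rewrite mem_nth ?ms.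
exists (nth 0 s); first split.
- move=> i j ij hj; apply: (sorted_ltn_nth ltn_trans) => //;
    by rewrite ?inE ?ms //; lia.
- by move=> i /sin /mem_mask; rewrite mem_iota.
- by move=> i j hi hj; rewrite -hE ?sE // !nE.
- move=> i /sin; rewrite in_mask ?iota_uniq // => /andP[+].
  rewrite mem_iota /= add0n => lt_sw.
  (* A position is its own index in [iota 0 (size w)]. *)
  rewrite -{1}[nth 0 s i](nth_iota 0 0 lt_sw) index_uniq ?iota_uniq //.
  by rewrite size_iota.
Qed.

Lemma embeds_contains (f : nat -> nat) (w p : seq nat) :
  embeds f w p -> contains w p.
Proof.
case=> fm fb fE; apply/existsP.
set s := mkseq f (size p).
have ms : size s = size p by rewrite size_mkseq.
have mP : size [seq i \in s | i <- iota 0 (size w)] == size w.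
  by rewrite size_map size_iota.
exists (Tuple mP) => /=; apply/order_isoP => /=.
have -> : mask [seq i \in s | i <- iota 0 (size w)] w =
          [seq nth 0 w i | i <- s].
  rewrite -[X in mask _ X](@mkseq_nth _ 0) /mkseq -map_mask -filter_mask.
  (* Both lists of positions are strictly increasing, so equal membership makes them equal. *)
  congr map; apply: (irr_sorted_eq ltn_trans ltnn).
  - by apply: (sorted_filter ltn_trans); exact: iota_ltn_sorted.
  - apply/(sortedP 0) => i; rewrite ms => hi.
    by rewrite !nth_mkseq; first apply: fm; lia.
  - move=> i; rewrite mem_filter mem_iota add0n /=.
    case E: (i \in s) => //=; case/mapP: E => j + ->.
    by rewrite mem_iota add0n; exact: fb.
rewrite size_map ms; split=> // i j hi hj.
have nE k : k < size p -> nth 0 [seq nth 0 w i | i <- s] k = nth 0 w (f k).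
  by move=> hk; rewrite (nth_map 0) ?ms // nth_mkseq.
by rewrite !nE // fE.
Qed.

Lemma containsP (w p : seq nat) :
  reflect (exists f, embeds f w p) (contains w p).
Proof.
apply: (iffP existsP) => [[m /instance_embeds[f hf _]]|[f /embeds_contains]].
  by exists f.
by move/existsP.
Qed.

Lemma embeds_comp (f g : nat -> nat) (u v w : seq nat) :
  embeds f u v -> embeds g v w -> embeds (f \o g) u w.
Proof.
move=> [fm fb fE] [gm gb gE]; split=> /=.
- by move=> i j ij hj; apply: fm; [apply: gm | apply: gb].
- by move=> i hi; apply/fb/gb.
- by move=> i j hi hj; rewrite fE ?gE ?gb.
Qed.

Lemma contains_trans (v u w : seq nat) :
  contains u v -> contains v w -> contains u w.
Proof.
move=> /containsP[f hf] /containsP[g hg]; apply/containsP.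
by exists (f \o g); exact: embeds_comp hf hg.
Qed.

Lemma order_iso_contains (u v : seq nat) : order_iso u v -> contains u v.
Proof.
case/order_isoP=> sE h; apply/containsP; exists id.
split=> //= [i|i j]; rewrite -sE //.
exact: h.
Qed.

Lemma order_iso_sym (u v : seq nat) : order_iso u v -> order_iso v u.
Proof.
case/order_isoP=> sE h; apply/order_isoP; split=> // i j hi hj.
by rewrite h ?sE.
Qed.

Lemma order_iso_trans (v u w : seq nat) :
  order_iso u v -> order_iso v w -> order_iso u w.
Proof.
case/order_isoP=> sE h /order_isoP[sE' h']; apply/order_isoP; split.
  by rewrite sE.
by move=> i j hi hj; rewrite h // h' -?sE.
Qed.

Lemma avoids132P (w : seq nat) : reflect (avoids132 w) (avoids w pat132).
Proof.
apply: (iffP idP) => [/negP h i j k ij jk kw ik kj|h].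
  apply/h/containsP; exists (nth 0 [:: i; j; k]); split.
  - by case=> [|[|[|a]]] [|[|[|b]]] //= _ _; lia.
  - by case=> [|[|[|a]]] //= _; lia.
  - by case=> [|[|[|a]]] [|[|[|b]]] //= _ _; lia.
apply/negP => /containsP[f [fm fb fE]].
apply: (h (f 0) (f 1) (f 2)); rewrite ?fE //; by [apply: fm | apply: fb].
Qed.

Lemma avoids132_embeds (f : nat -> nat) (w p : seq nat) :
  embeds f w p -> avoids132 w -> avoids132 p.
Proof.
move=> hf /avoids132P h; apply/avoids132P; apply: contra h.
by apply: contains_trans; apply: embeds_contains hf.
Qed.

(** * Order types of permutations and standardization *)

Lemma nth_perm_iota (n : nat) (w : seq nat) (i : nat) :
  perm_eq w (iota 1 n) -> i < n ->
  nth 0 w i = (count (fun j => nth 0 w j < nth 0 w i) (iota 0 n)).+1.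
Proof.
move=> pw hi; have sw : size w = n by rewrite (perm_size pw) size_iota.
have : nth 0 w i \in w by rewrite mem_nth ?sw.
rewrite (perm_mem pw) mem_iota; set x := nth 0 w i => hx.
have -> : count (fun j => nth 0 w j < x) (iota 0 n) = count (ltn^~ x) w.
  by rewrite -[in RHS](@mkseq_nth _ 0 w) /mkseq count_map sw.
rewrite (permP pw).
(* Cut the values from 1 to [n] just below [x]: the first block is counted entirely, the second not
   at all. *)
have -> : n = x.-1 + (n - x.-1) by lia.
rewrite iotaD count_cat (eq_in_count (a2 := xpredT)) => [|y]; last first.
  by rewrite mem_iota /=; lia.
rewrite count_predT size_iota (eq_in_count (a2 := xpred0)) => [|y]; last first.
  by rewrite mem_iota /=; lia.
by rewrite count_pred0; lia.
Qed.

(** By [nth_perm_iota] each value is a function of the comparisons alone, and these agree. *)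
Lemma order_iso_perm_eq (n : nat) (u v : seq nat) :
  perm_eq u (iota 1 n) -> perm_eq v (iota 1 n) -> order_iso u v -> u = v.
Proof.
move=> pu pv /order_isoP[sE h].
have su : size u = n by rewrite (perm_size pu) size_iota.
apply: (eq_from_nth (x0 := 0) sE) => i; rewrite su => hi.
rewrite (nth_perm_iota pu) // (nth_perm_iota pv) //; congr S.
by apply: eq_in_count => j; rewrite mem_iota => hj; apply: h; lia.
Qed.

(** Entries become their ranks, starting at 1; for duplicate-free [u] this is the permutation with
    the order type of [u]. *)
Definition standardize (u : seq nat) : seq nat :=
  [seq (count (ltn^~ x) u).+1 | x <- u].

(** The inequality is strict because [x] itself is counted on the right but not on the left. *)
Lemma count_ltn (u : seq nat) (x y : nat) :
  x \in u -> x < y -> count (ltn^~ x) u < count (ltn^~ y) u.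
Proof.
move=> xu xy.
have : count (predU (ltn^~ x) (pred1 x)) u <= count (ltn^~ y) u.
  by apply: sub_count => z /=; lia.
have := count_predUI (ltn^~ x) (pred1 x) u.
have -> : count (predI (ltn^~ x) (pred1 x)) u = 0.
  by rewrite -(count_pred0 u); apply: eq_count => z /=;
    case: eqVneq => [->|_]; rewrite ?ltnn ?andbF.
rewrite addn0 => ->; apply: leq_trans.
by rewrite -addn1 leq_add2l -has_count has_pred1.
Qed.

Lemma standardize_iso (u : seq nat) : order_iso u (standardize u).
Proof.
apply/order_isoP; rewrite size_map; split=> // i j hi hj.
rewrite !(nth_map 0) // ltnS.
case: (ltngtP (nth 0 u i) (nth 0 u j)) => [h|h|->]; last by rewrite ltnn.
  by rewrite count_ltn ?mem_nth.
by apply/esym/negbTE; rewrite -leqNgt ltnW // count_ltn ?mem_nth.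
Qed.

Lemma standardize_perm (u : seq nat) :
  uniq u -> perm_eq (standardize u) (iota 1 (size u)).
Proof.
move=> uu.
have us : uniq (standardize u).
  rewrite map_inj_in_uniq // => x y xu yu [E].
  case: (ltngtP x y) => // xy.
    by have := count_ltn xu xy; rewrite E ltnn.
  by have := count_ltn yu xy; rewrite E ltnn.
apply: uniq_perm; rewrite ?iota_uniq //.
(* A duplicate-free list contained in a list of the same length has the same members. *)
suff sub : {subset standardize u <= iota 1 (size u)}.
  by apply: (uniq_min_size us sub _).2; rewrite size_map size_iota.
move=> x /mapP[y yu ->]; rewrite mem_iota.
suff : count (ltn^~ y) u < size u by rewrite add1n ltnS.
rewrite ltn_neqAle count_size andbT -all_count.
by apply/negP => /allP/(_ _ yu); rewrite /= ltnn.
Qed.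

(** * Decreasing trees and 132-avoidance *)

Definition root_layout (l : seq nat) (x : nat) (r : seq nat) : Prop :=
  [/\ forall i, i < size l -> nth 0 l i < x,
      forall i, i < size r -> nth 0 r i < x
    & forall i j, i < size l -> j < size r -> nth 0 r j < nth 0 l i].

Lemma nth_node (l : seq nat) (x : nat) (r : seq nat) (i : nat) :
  nth 0 (l ++ x :: r) i =
  if i < size l then nth 0 l i
  else if i == size l then x else nth 0 r (i - (size l).+1).
Proof.
rewrite nth_cat; case: ltngtP => // [h|->]; last by rewrite subnn.
by have -> : i - size l = (i - (size l).+1).+1 by lia.
Qed.

Lemma root_layoutP (l : tree nat) (x : nat) (r : tree nat) :
  decreasing (Node l x r) -> left_above_right (Node l x r) ->
  root_layout (inorder l) x (inorder r).
Proof.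
move=> /= /and4P[/allP hl /allP hr _ _] /and3P[/allP h _ _].
split=> [i hi|i hi|i j hi hj].
- by apply/hl/mem_nth.
- by apply/hr/mem_nth.
- have /allP/(_ (nth 0 (inorder r) j)) := h _ (mem_nth 0 hi).
  by apply; apply: mem_nth.
Qed.

(** Consider the last position [k] of a supposed 132. Left of the root, the whole instance lies in
    [l]; at the root, its entry is too large. Right of the root, the first entry is too large if it
    is in [l] or is the root, and otherwise the instance lies in [r]. *)
Lemma avoids132_node (l : seq nat) (x : nat) (r : seq nat) :
  root_layout l x r -> avoids132 l -> avoids132 r -> avoids132 (l ++ x :: r).
Proof.
move=> [hl hr hlr] al ar i j k ij jk; rewrite size_cat /= => hk.
rewrite !nth_node.
case: (ltngtP k (size l)) => ck.
- by rewrite (ltn_trans jk ck) (ltn_trans ij (ltn_trans jk ck)); apply: al.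
- case: (ltngtP i (size l)) => ci.
  + by have := hlr i (k - (size l).+1) ci; lia.
  + by case: (ltngtP j (size l)) => cj; [lia | apply: ar; lia | lia].
  + by have := hr (k - (size l).+1); lia.
- rewrite -ck jk; have := hl j; lia.
Qed.

Lemma decreasing_avoids132 (t : tree nat) :
  decreasing t -> left_above_right t -> avoids132 (inorder t).
Proof.
elim: t => [|l IHl x r IHr] dt lar //=.
have rl := root_layoutP dt lar.
case/and4P: dt => _ _ dl dr; case/and3P: lar => _ al ar.
by apply: avoids132_node rl _ _; [apply: IHl | apply: IHr].
Qed.

(** Around the maximum [x], an entry [y] on its left and a larger entry [z] on its right would make
    [y], [x], [z] an instance of 132; equality of [y] and [z] is excluded by [uniq w]. *)
Lemma treeof_decreasing (w : seq nat) :
  uniq w -> avoids132 w -> decreasing (treeof w) && left_above_right (treeof w).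
Proof.
have [n] := ubnP (size w); elim: n w => // n IH w hw uw aw.
have [->//|w0] := eqVneq w [::]; have [ht hd] := size_split_max w0.
set l := take _ w in ht; set r := drop _ w in hd; set x := maxentry w.
have wE : w = l ++ x :: r.
  by rewrite -{1}[w]inorder_treeof treeofE //= !inorder_treeof.
have [nl nr] : (forall i, i < size l -> nth 0 w i = nth 0 l i) /\
               (forall i, nth 0 w (size l + i.+1) = nth 0 r i).
  split=> [i hi|i]; rewrite wE nth_node ?hi //.
  by rewrite ltnNge leq_addr -[X in _ == X]addn0 eqn_add2l addnS subSS addKn.
have sw : size w = size l + (size r).+1 by rewrite {1}wE size_cat.
have /and4P[ul xl ur dis] :
    [&& uniq l, x \notin l, uniq (x :: r) & ~~ has (mem l) r].
  by move: uw; rewrite {1}wE cat_uniq /= negb_or => /and3P[-> /andP[-> ->] ->].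
have lt_max y : y \in l ++ r -> y < x.
  move=> hy; rewrite ltn_neqAle maxentry_ge ?andbT.
    apply: contraTneq hy => ->; rewrite mem_cat negb_or xl.
    by move: ur => /= /andP[].
  by rewrite wE; move: hy; rewrite !mem_cat inE => /orP[->|->]; rewrite ?orbT.
have /andP[dl al] : decreasing (treeof l) && left_above_right (treeof l).
  apply: IH => //; first lia.
  move=> i j k ij jk kl; have jl := ltn_trans jk kl.
  rewrite -!nl ?(ltn_trans ij) //; apply: aw => //.
  by rewrite sw ltn_addr.
have /andP[dr ar] : decreasing (treeof r) && left_above_right (treeof r).
  apply: IH; [lia | by case/andP: ur | ].
  move=> i j k ij jk kr; rewrite -!nr.
  by apply: aw; rewrite ?sw ?ltn_add2l.
rewrite treeofE //= -/l -/r -/x !inorder_treeof dl dr al ar !andbT -andbA.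
apply/and3P; split; apply/allP => y hy.
- by rewrite lt_max // mem_cat hy.
- by rewrite lt_max // mem_cat hy orbT.
apply/allP => z hz; rewrite ltnNge leq_eqVlt; apply/negP => /orP[/eqP E|yz].
  by move/hasP: dis; apply; exists z => //=; rewrite -E.
have [i hi yE] := nthP 0 hy; have [j hj zE] := nthP 0 hz.
have zx : z < x by rewrite lt_max // mem_cat hz orbT.
have nx : nth 0 w (size l) = x by rewrite wE nth_node ltnn eqxx.
apply: (aw i (size l) (size l + j.+1)); rewrite ?nr ?nx ?nl ?yE ?zE //.
  by rewrite -[X in X < _]addn0 ltn_add2l.
by rewrite sw ltn_add2l ltnS.
Qed.

(** * Even-indexed entries and completed trees *)

Definition even_entries (v : seq nat) : seq nat :=
  mkseq (fun i => nth 0 v i.*2.+1) (size v)./2.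

Lemma nth_even_entries (v : seq nat) (i : nat) :
  i < (size v)./2 -> nth 0 (even_entries v) i = nth 0 v i.*2.+1.
Proof. exact: nth_mkseq. Qed.

(** With [size l] odd, the root falls on an odd 0-based position, hence is an even-indexed entry,
    and positions in [r] are shifted by the even number [(size l).+1]. *)
Lemma even_entries_node (l : seq nat) (x : nat) (r : seq nat) :
  odd (size l) -> odd (size r) ->
  even_entries (l ++ x :: r) = even_entries l ++ x :: even_entries r.
Proof.
move=> ol odr; apply: (eq_from_nth (x0 := 0)).
  by rewrite size_cat /= !size_mkseq size_cat /=; lia.
move=> i; rewrite size_mkseq size_cat /= => hi.
rewrite nth_even_entries ?size_cat // !nth_node size_mkseq.
case: (ltngtP i (size l)./2) => ci.
- rewrite nth_even_entries //; have -> // : i.*2.+1 < size l by lia.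
- case: (ltngtP i.*2.+1 (size l)) => ci'; try lia.
  by rewrite nth_even_entries; [congr nth; lia | lia].
- by case: (ltngtP i.*2.+1 (size l)) => //; lia.
Qed.

(** Comparisons between different parts are dictated by the layout, hence the same on both sides. *)
Lemma order_iso_node (l l' : seq nat) (x x' : nat) (r r' : seq nat) :
  root_layout l x r -> root_layout l' x' r' ->
  order_iso l l' -> order_iso r r' -> order_iso (l ++ x :: r) (l' ++ x' :: r').
Proof.
move=> [hl hr h] [hl' hr' h'] /order_isoP[sl il] /order_isoP[sr ir].
apply/order_isoP; split; first by rewrite !size_cat /= sl sr.
move=> i j; rewrite !size_cat /= => hi hj; rewrite !nth_node -!sl.
rewrite -!sl -?sr in hl' hr' h' *.
case: (ltngtP i (size l)) => ci; case: (ltngtP j (size l)) => cj.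
- exact: il.
- have jr : j - (size l).+1 < size r by lia.
  by rewrite !leq_gtF // ltnW // (h, h').
- by rewrite hl ?hl'.
- by rewrite h ?h' //; lia.
- by apply: ir; lia.
- by rewrite hr ?hr' //; lia.
- by rewrite !leq_gtF // ltnW // (hl, hl').
- have jr : j - (size l).+1 < size r by lia.
  by rewrite !leq_gtF // ltnW // (hr, hr').
- by rewrite !ltnn.
Qed.

(** Having odd length, [l] ends in a valley and [r] starts with one, so the larger root between them
    is a peak. *)
Lemma alternating_node (l : seq nat) (x : nat) (r : seq nat) :
  root_layout l x r -> odd (size l) -> odd (size r) ->
  alternating l -> alternating r -> alternating (l ++ x :: r).
Proof.
move=> [hl hr _] ol odr /alternatingP al /alternatingP ar.
apply/alternatingP => i; rewrite size_cat /= => hi; rewrite !nth_node.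
case: (ltngtP i (size l)) => ci; case: (ltngtP i.+1 (size l)) => ci'; try lia.
- exact: al.
- have -> : odd i = false by lia.
  exact: hl.
- have := ar (i - (size l).+1).
  have -> : odd (i - (size l).+1) = odd i by lia.
  have -> : i.+1 - (size l).+1 = (i - (size l).+1).+1 by lia.
  by apply; lia.
- rewrite ci ol; apply: hr; lia.
Qed.

Lemma size_inorder_completion (s : utree) (t : tree nat) :
  erase t = completion s -> size (inorder t) = (nvertices s).*2.+1.
Proof.
move=> E; rewrite -/(nvertices t) -nvertices_erase E.
exact: nvertices_completion.
Qed.

Lemma odd_inorder_completion (s : utree) (t : tree nat) :
  erase t = completion s -> odd (size (inorder t)).
Proof. by move/size_inorder_completion=> ->; rewrite /= odd_double. Qed.

Lemma alternating_completion (s : utree) (t : tree nat) :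
  erase t = completion s -> decreasing t -> left_above_right t ->
  alternating (inorder t).
Proof.
elim: s t => [|l IHl [] r IHr] [|tl x tr] //=.
  by case: tl => //; case: tr => // _ _ _; apply/alternatingP.
case=> El Er dt lar; have rl := root_layoutP dt lar.
case/and4P: dt => _ _ dl dr; case/and3P: lar => _ al ar.
apply: alternating_node rl _ _ _ _.
- exact: odd_inorder_completion El.
- exact: odd_inorder_completion Er.
- exact: IHl.
- exact: IHr.
Qed.

(** Read in inorder, the original vertices of a completion alternate with the added leaves, and the
    two labeling conditions fix every comparison between original vertices. *)
Lemma order_iso_even_entries_completion (t t' : tree nat) :
  erase t' = completion (erase t) ->
  decreasing t -> left_above_right t -> decreasing t' -> left_above_right t' ->
  order_iso (inorder t) (even_entries (inorder t')).
Proof.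
elim: t t' => [|l IHl x r IHr] [|l' x' r'] //=.
  by case: l' => //; case: r' => // _ _ _ _ _; apply/order_isoP.
case=> El Er dt lar dt' at'.
have rl := root_layoutP dt lar; have rl' := root_layoutP dt' at'.
case/and4P: dt => _ _ dl dr; case/and3P: lar => _ al ar.
case/and4P: dt' => _ _ dl' dr'; case/and3P: at' => _ al' ar'.
have ol := odd_inorder_completion El; have odr := odd_inorder_completion Er.
rewrite even_entries_node //; apply: order_iso_node;
  [exact: rl | | exact: IHl | exact: IHr].
case: rl' => hl hr h.
split=> [i|i|i j]; rewrite !size_mkseq => hi.
- by rewrite nth_even_entries //; apply: hl; lia.
- by rewrite nth_even_entries //; apply: hr; lia.
- by move=> hj; rewrite !nth_even_entries //; apply: h; lia.
Qed.

(** * Basic properties of [phi] *)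

Lemma size_phi (w : seq nat) : size (phi w) = (size w).*2.+1.
Proof. by rewrite (perm_size (perm_phi w)) size_iota. Qed.

Lemma phi_uniq (w : seq nat) : uniq (phi w).
Proof. by rewrite (perm_uniq (perm_phi w)) iota_uniq. Qed.

Lemma phi_avoids132 (w : seq nat) : avoids132 (phi w).
Proof.
by have [_ _ d a] := assoc_labelingP (completion (erase (treeof w)));
  apply: decreasing_avoids132.
Qed.

Lemma phi_alternating (w : seq nat) : alternating (phi w).
Proof.
by have [E _ d a] := assoc_labelingP (completion (erase (treeof w)));
  apply: alternating_completion E d a.
Qed.

Lemma phi_even_entries (w : seq nat) :
  uniq w -> avoids132 w -> order_iso w (even_entries (phi w)).
Proof.
move=> uw aw; have /andP[dw lw] := treeof_decreasing uw aw.
have [E _ d a] := assoc_labelingP (completion (erase (treeof w))).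
by rewrite -{1}[w]inorder_treeof; apply: order_iso_even_entries_completion.
Qed.

(** * Valleys and peaks of alternating 132-avoiding sequences *)

Section AlternatingAvoiders.

Variables (n : nat) (v : seq nat).
Hypotheses (sv : size v = n.*2.+1) (uv : uniq v)
           (av : alternating v) (rv : avoids132 v).

(** In 0-based positions the valleys are at [i.*2] for [i <= n] and the peaks at [i.*2.+1] for
    [i < n]; no peak follows the last valley. *)
Lemma alternating_ascent (i : nat) : i < n -> nth 0 v i.*2 < nth 0 v i.*2.+1.
Proof.
move=> hi; have := alternatingP _ av i.*2; rewrite odd_double sv; apply; lia.
Qed.

Lemma alternating_descent (i : nat) :
  i < n -> nth 0 v i.+1.*2 < nth 0 v i.*2.+1.
Proof.
move=> hi; have := alternatingP _ av i.*2.+1; rewrite /= odd_double sv.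
by apply; lia.
Qed.

Lemma nth_neq (i j : nat) : i < j -> j <= n.*2 -> nth 0 v i != nth 0 v j.
Proof. by move=> ij hj; rewrite nth_uniq ?sv //; lia. Qed.

(* A smaller entry [v_j] before the valley [v_2i], together with the peak
   preceding the valley, would be an instance of 132. *)
Lemma valley_lt (i j : nat) : i <= n -> j < i.*2 -> nth 0 v i.*2 < nth 0 v j.
Proof.
case: i => // i hi hj; have d := alternating_descent hi.
have [->//|ne] := eqVneq j i.*2.+1.
rewrite ltnNge leq_eqVlt (negbTE (nth_neq _ _)); try lia.
apply/negP => h.
by apply: (rv (i := j) (j := i.*2.+1) (k := i.+1.*2)) => //; lia.
Qed.

(** For [i <= j], a valley below peak [j] whose own peak exceeds peak [j] would start a 132. When
    [i = n] the first disjunct holds, so the default value read past the end is harmless. *)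
Lemma valley_lt_peak (i j : nat) : i <= n -> j < n ->
  (nth 0 v i.*2 < nth 0 v j.*2.+1) =
  (j < i) || (nth 0 v i.*2.+1 <= nth 0 v j.*2.+1).
Proof.
move=> hi hj; case: (ltnP j i) => ji /=; first by rewrite valley_lt //; lia.
have a : nth 0 v i.*2 < nth 0 v i.*2.+1 by apply: alternating_ascent; lia.
case: (leqP (nth 0 v i.*2.+1) (nth 0 v j.*2.+1)) => h; first lia.
apply/negbTE/negP => h'.
have ne : i <> j by move=> E; rewrite E ltnn in h.
by apply: (rv (i := i.*2) (j := i.*2.+1) (k := j.*2.+1)); lia.
Qed.

Lemma valley_lt_valley (i j : nat) : i <= n -> j <= n ->
  (nth 0 v i.*2 < nth 0 v j.*2) = (j < i).
Proof.
move=> hi hj; case: (ltngtP j i) => [h|h|->]; last by rewrite ltnn.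
  by rewrite valley_lt //; lia.
by rewrite ltnNge ltnW // valley_lt //; lia.
Qed.

Lemma peak_lt_valley (i j : nat) : i < n -> j <= n ->
  (nth 0 v i.*2.+1 < nth 0 v j.*2) = ~~ (nth 0 v j.*2 < nth 0 v i.*2.+1).
Proof.
move=> hi hj; rewrite -leqNgt [RHS]leq_eqVlt.
have : nth 0 v i.*2.+1 != nth 0 v j.*2 by rewrite nth_uniq ?sv //; lia.
by move/negbTE=> ->.
Qed.

End AlternatingAvoiders.

(** Every comparison that involves a valley reduces to positions and to comparisons between
    peaks. *)
Lemma order_iso_even_entries (n : nat) (u v : seq nat) :
  size u = n.*2.+1 -> size v = n.*2.+1 -> uniq u -> uniq v ->
  alternating u -> alternating v -> avoids132 u -> avoids132 v ->
  (forall i j, i < n -> j < n ->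
     (nth 0 u i.*2.+1 < nth 0 u j.*2.+1) =
     (nth 0 v i.*2.+1 < nth 0 v j.*2.+1)) ->
  order_iso u v.
Proof.
move=> su sv uu uv au av ru rv h; apply/order_isoP; split; first by rewrite su.
have VP i j : i <= n -> j < n ->
    (nth 0 u i.*2 < nth 0 u j.*2.+1) = (nth 0 v i.*2 < nth 0 v j.*2.+1).
  move=> hi hj; rewrite (valley_lt_peak su) // (valley_lt_peak sv) //.
  case: (ltnP j i) => //= ji.
  by rewrite [LHS]leqNgt [RHS]leqNgt h //; lia.
(* Writing each position as its parity plus twice its half separates peaks from valleys. *)
move=> i j; rewrite su -[i]odd_double_half -[j]odd_double_half.
move: (odd i) (odd j) (i./2) (j./2) => [] [] {}i {}j;
  rewrite ?add1n ?add0n => hi hj.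
- by apply: h; lia.
- by rewrite (peak_lt_valley su) ?(peak_lt_valley sv) ?VP //; lia.
- by apply: VP; lia.
- by rewrite (valley_lt_valley su) ?(valley_lt_valley sv) //; lia.
Qed.

(** Uniqueness of [phi w] up to order type. As [v] need not be a permutation, this applies to
    subsequences of another [phi] image as well as to members of the target set. *)
Lemma order_iso_phi (w v : seq nat) :
  uniq w -> avoids132 w -> size v = (size w).*2.+1 -> uniq v ->
  alternating v -> avoids132 v -> order_iso (even_entries v) w ->
  order_iso (phi w) v.
Proof.
move=> uw aw sv uv alv av ivw.
apply: (order_iso_even_entries (n := size w)) => //.
- exact: size_phi.
- exact: phi_uniq.
- exact: phi_alternating.
- exact: phi_avoids132.
move=> i j hi hj.
have /order_isoP[_ h] := phi_even_entries uw aw.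
have /order_isoP[_ h'] := ivw.
rewrite -!nth_even_entries ?size_phi ?sv; try lia.
by rewrite -h // h' // size_mkseq sv; lia.
Qed.

(** * Transfer of patterns between [w] and [phi w] *)

Lemma embeds_phi (w : seq nat) :
  uniq w -> avoids132 w -> embeds (fun i => i.*2.+1) (phi w) w.
Proof.
move=> uw aw; split=> [i j|i|i j hi hj]; rewrite ?size_phi; try lia.
have /order_isoP[_ ->] // := phi_even_entries uw aw.
by rewrite !nth_even_entries // size_phi; lia.
Qed.

(* An instance of [p] among the even-indexed entries extends to one of [phi p]
   by adding the entry just before each of its members and the last entry. *)
Lemma phi_contains (w p : seq nat) :
  uniq w -> avoids132 w -> uniq p -> contains w p -> contains (phi w) (phi p).
Proof.
move=> uw aw up /containsP[f hf].
have ap : avoids132 p := avoids132_embeds hf aw.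
have [fm fb fE] := hf; have [_ _ gE] := embeds_phi uw aw.
set g := fun i => if odd i then (f i./2).*2.+1
                  else if i./2 < size p then (f i./2).*2 else (size w).*2.
have gP i : g i.*2.+1 = (f i).*2.+1.
  by rewrite /g /= odd_double /= uphalf_double.
have gV i : i < size p -> g i.*2 = (f i).*2.
  by move=> hi; rewrite /g odd_double doubleK hi.
have gL : g (size p).*2 = (size w).*2 by rewrite /g odd_double doubleK ltnn.
have gb i : i < (size p).*2.+1 -> g i < size (phi w).
  rewrite size_phi -[i]odd_double_half; move: (odd i) (i./2) => [] {}i;
    rewrite ?add1n ?add0n => hi.
    by rewrite gP; have := fb i; lia.
  have [->|ne] := eqVneq i (size p); first by rewrite gL.
  by rewrite gV; have := fb i; lia.
have gS i : i.+1 < (size p).*2.+1 -> g i < g i.+1.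
  rewrite -[i]odd_double_half; move: (odd i) (i./2) => [] {}i;
    rewrite ?add1n ?add0n => hi; last by rewrite gP gV; lia.
  rewrite gP -(doubleS i); have [->|ne] := eqVneq i.+1 (size p).
    by rewrite gL; have := fb i; lia.
  by rewrite gV; [have := fm i i.+1 |]; lia.
have gm i j : i < j -> j < (size p).*2.+1 -> g i < g j.
  elim: j => // j IH; rewrite ltnS leq_eqVlt => /orP[/eqP->|ij] hj.
    exact: gS.
  by apply: ltn_trans (gS _ hj); apply: IH => //; lia.
(* The selected subsequence [v] is shown to alternate, to avoid 132 and to have peaks ordered as
   [p]; [order_iso_phi] then identifies its order type with that of [phi p]. *)
set v := mkseq (fun i => nth 0 (phi w) (g i)) (size p).*2.+1.
have sv : size v = (size p).*2.+1 by rewrite size_mkseq.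
have nv i : i < (size p).*2.+1 -> nth 0 v i = nth 0 (phi w) (g i).
  by move=> hi; rewrite nth_mkseq.
have hv : embeds g (phi w) v.
  by split; rewrite sv // => i j hi hj; rewrite !nv.
apply: (contains_trans (embeds_contains hv)).
apply/order_iso_contains/order_iso_sym/order_iso_phi => //.
- rewrite map_inj_in_uniq ?iota_uniq // => i j; rewrite !mem_iota => hi hj /eqP.
  rewrite nth_uniq ?phi_uniq ?gb // => /eqP E.
  case: (ltngtP i j) => // ij.
    by have := gm i j ij hj; rewrite E ltnn.
  by have := gm j i ij hi; rewrite E ltnn.
- apply/alternatingP => i; rewrite sv => hi; rewrite !nv //; last lia.
  have sw := size_phi w; have uphi := phi_uniq w.
  have rw := @phi_avoids132 w; have alw := phi_alternating w.
  move: hi; rewrite -[i]odd_double_half; move: (odd i) (i./2) => [] {}i;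
    rewrite ?add1n ?add0n => hi; rewrite /= odd_double.
    (* The next selected valley need not be adjacent to the peak in [phi w], so the descent comes
       from [valley_lt] rather than from alternation. *)
    have /= := gS i.*2.+1; rewrite gP -(doubleS i).
    have [->|ne] := eqVneq i.+1 (size p).
      by rewrite gL => h; apply: (valley_lt sw) => //; apply: h; lia.
    have lt_ip : i.+1 < size p by lia.
    rewrite gV // => h; apply: (valley_lt sw) => //; last by apply: h; lia.
    exact/ltnW/fb.
  rewrite gP gV; last lia.
  by apply: (alternating_ascent sw) => //; apply: fb; lia.
- exact: avoids132_embeds hv (@phi_avoids132 w).
- apply/order_isoP; rewrite size_mkseq sv; split; first lia.
  move=> i j hi hj; rewrite !nth_even_entries ?sv // !nv; try lia.
  by rewrite !gP gE ?fb ?fE //; lia.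
Qed.

Lemma contains_of_phi (w q p : seq nat) (m : (size q).-tuple bool) :
  uniq w -> avoids132 w -> contains (phi w) q -> lr_min_free_instance p m ->
  contains w p.
Proof.
move=> uw aw /containsP[f [fm fb fE]].
case/andP=> /instance_embeds[g [gm gb gE] gI] /forallP nm.
(* A valley of [phi w] is below all earlier entries, so an entry of [q] sent to a valley would be a
   left-to-right minimum of [q]. *)
have odd_fg i : i < size p -> odd (f (g i)).
  move=> hi; have hgi := gb i hi.
  have := nm (Ordinal hgi); rewrite (tnth_nth false) gI //= => /forallP h.
  apply: contraT => ev; exfalso; apply: h => j /=.
  have jg := ltn_ord j; rewrite -fE //; last lia.
  have -> : f (g i) = (f (g i))./2.*2 by lia.
  have := fb _ hgi; rewrite size_phi => hb.
  apply: (valley_lt (size_phi w)).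
  - exact: phi_uniq.
  - exact: phi_alternating.
  - exact: phi_avoids132.
  - lia.
  - by have := fm j (g i); lia.
have hE i : i < size p -> f (g i) = (f (g i))./2.*2.+1.
  by move=> /odd_fg; lia.
have [_ _ eE] := embeds_phi uw aw.
have hb i : i < size p -> (f (g i))./2 < size w.
  move=> hi; have := fb _ (gb _ hi); have := odd_fg i hi.
  by rewrite size_phi; lia.
(* Peak [a.*2.+1] of [phi w] corresponds to position [a] of [w]; halving is strictly monotone on odd
   positions. *)
apply/containsP; exists (fun i => (f (g i))./2).
split=> // [i j ij hj|i j hi hj].
- have hi : i < size p by lia.
  have := fm _ _ (gm _ _ ij hj) (gb _ hj).
  by have := odd_fg i hi; have := odd_fg j hj; lia.
- by rewrite -eE ?hb // -!hE // fE ?gb // gE.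
Qed.

(** * Bijectivity of [phi] *)

Lemma phi_inj (n : nat) (u w : seq nat) :
  perm_eq u (iota 1 n) -> perm_eq w (iota 1 n) -> avoids132 u -> avoids132 w ->
  phi u = phi w -> u = w.
Proof.
move=> pu pw au aw E; apply: (order_iso_perm_eq pu pw).
have uu : uniq u by rewrite (perm_uniq pu) iota_uniq.
have uw : uniq w by rewrite (perm_uniq pw) iota_uniq.
(* Both [u] and [w] have the order type of the peaks of their common image. *)
apply: order_iso_trans (phi_even_entries uu au) _; rewrite E.
exact/order_iso_sym/phi_even_entries.
Qed.

(** The preimage is the standardization of the peaks of [v]. It avoids 132 because [v] contains it,
    and uniqueness up to order type becomes equality between permutations of the same length. *)
Lemma phi_surj (n : nat) (v : seq nat) :
  perm_eq v (iota 1 n.*2.+1) -> alternating v -> avoids132 v ->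
  exists w, [/\ perm_eq w (iota 1 n), avoids132 w & phi w = v].
Proof.
move=> pv alv av; set w := standardize (even_entries v).
have sv : size v = n.*2.+1 by rewrite (perm_size pv) size_iota.
have uv : uniq v by rewrite (perm_uniq pv) iota_uniq.
have se : size (even_entries v) = n by rewrite size_mkseq sv /= uphalf_double.
have ue : uniq (even_entries v).
  rewrite map_inj_in_uniq ?iota_uniq // => i j.
  rewrite !mem_iota sv => hi hj /eqP.
  by rewrite nth_uniq ?sv; lia.
have pw : perm_eq w (iota 1 n) by rewrite -se standardize_perm.
have iw : order_iso (even_entries v) w := standardize_iso _.
have aw : avoids132 w.
  have /order_isoP[sE hE] := iw.
  apply: (avoids132_embeds (f := fun i => i.*2.+1)) av; split=> [i j|i|i j];
    rewrite -sE se ?sv; try lia.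
  by move=> hi hj; rewrite -hE ?se // !nth_even_entries // sv; lia.
exists w; split=> //; apply: (order_iso_perm_eq _ pv).
  by rewrite -(size_iota 1 n) -(perm_size pw) perm_phi.
apply: order_iso_phi => //; first by rewrite (perm_uniq pw) iota_uniq.
by rewrite (perm_size pw) size_iota.
Qed.

Theorem theorem4p1 (k : nat) (p q : k.-tuple (seq nat))
  (p_perm : forall i : 'I_k, is_perm (tnth p i))
  (p_132 : forall i : 'I_k, avoids (tnth p i) pat132)
  (q_perm : forall i : 'I_k, is_perm (tnth q i))
  (q_phi : forall i : 'I_k, contains (phi (tnth p i)) (tnth q i))
  (p_in_q : forall i : 'I_k, exists m : (size (tnth q i)).-tuple bool,
     lr_min_free_instance (tnth p i) m)
  (n : nat) :
  let Sn := Sav n (pat132 :: p) in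
  let An := Aav (2 * n + 1) (pat132 :: q) in
  [/\ forall w, w \in Sn -> phi w \in An,
      {in Sn &, injective phi},
      forall v, v \in An -> exists2 w, w \in Sn & phi w = v
    & size Sn = size An].
Proof.
move=> Sn An.
have memS w : reflect [/\ perm_eq w (iota 1 n), avoids132 w
                        & forall i, avoids w (tnth p i)] (w \in Sn).
  rewrite mem_Sav; apply: (iffP and3P) => -[pw aw h]; split=> //.
  - exact/avoids132P.
  - exact/all_tnthP.
  - exact/avoids132P.
  - exact/all_tnthP.
have memA v : reflect [/\ perm_eq v (iota 1 n.*2.+1), alternating v, avoids132 v
                        & forall i, avoids v (tnth q i)] (v \in An).
  rewrite mem_filter mem_Sav mul2n addn1.
  apply: (iffP and4P) => -[pw aw h h']; split=> //;
    by [apply/avoids132P | apply/all_tnthP].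
have uP w : perm_eq w (iota 1 n) -> uniq w.
  by move=> pw; rewrite (perm_uniq pw) iota_uniq.
have up i : uniq (tnth p i) by rewrite (perm_uniq (p_perm i)) iota_uniq.
have phiA w : w \in Sn -> phi w \in An.
  case/memS=> pw aw h; apply/memA; split.
  - by rewrite -(size_iota 1 n) -(perm_size pw) perm_phi.
  - exact: phi_alternating.
  - exact: phi_avoids132.
  - move=> i; apply: contra (h i) => hq; have [m hm] := p_in_q i.
    exact: contains_of_phi (uP _ pw) aw hq hm.
have inj : {in Sn &, injective phi}.
  by move=> u w /memS[pu au _] /memS[pw aw _]; apply: phi_inj pu pw au aw.
have surj v : v \in An -> exists2 w, w \in Sn & phi w = v.
  case/memA=> pv alv av h; have [w [pw aw E]] := phi_surj pv alv av.
  exists w => //; apply/memS; split=> // i; apply: contra (h i) => hp.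
  (* An instance of the [i]-th [p] in [w] puts its image under [phi] inside [phi w], and the [i]-th
     [q] is contained in that image. *)
  rewrite -E; apply: contains_trans (q_phi i).
  exact: phi_contains (uP _ pw) aw (up i) hp.
(* The cardinalities agree because the image list of [Sn] is duplicate-free with the same members as
   [An]. *)
split=> //; rewrite -(size_map phi); apply/perm_size/uniq_perm.
- by rewrite map_inj_in_uniq // Sav_uniq.
- exact: Aav_uniq.
- move=> v; apply/mapP/idP => [[w hw ->]|/surj[w hw <-]]; first exact: phiA.
  by exists w.
Qed.
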